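(* Let $d\ge 3$ and $n\ge 1$ be integers. For all $L>1$ and all $\varepsilon>0$, there exists a positive constant $C_{\varepsilon,n}$ (which may depend on $L$ and $d$) such that for all integers $M\ge 2$, $$\mathbb{P}\big(\mathbf{Over}(M,\varepsilon,n)\big)\le \frac{C_{\varepsilon,n}}{M^L},$$ where $\mathbf{Over}(M,\varepsilon,n)$ is the event $$\mathbf{Over}(M,\varepsilon,n)=\bigcup_{l\ge M}\big\{\exists z\in\mathcal{H}:\ \|z\|=l,\ X_z(n)>\varepsilon l\big\}$$ (the union being over integers $l\ge M$).
   Context: Let $\mathcal{H}=\{0\}\times\mathbb{Z}^{d-1}\subset\mathbb{Z}^d$ (the set of sources). Use the norm $\|(z_1,\dots,z_d)\|=\max_i|z_i|$. The level $M$ is the set of sources $z\in\mathcal{H}$ with $\|z\|=M$. A particle sent from a source $z$, when the current aggregate is a finite set $A\subset\mathbb{Z}^d$, is a simple symmetric random walk on $\mathbb{Z}^d$ started at $z$ (independent of everything else) and stopped at the first time it is at a site not in $A$; the site where it stops is added to $A$ (if $z\notin A$ the particle stops immediately at $z$). For an integer $n\ge 0$, the aggregates $(A_n[M])_{M\ge 0}$ are defined inductively: $A_n[0]$ is obtained from the empty set by sending $n$ particles successively from the origin; given $A_n[M-1]$, the aggregate $A_n[M]$ is obtained by sending successively $n$ particles from each source of level $M$, the sources being taken in lexicographical order. The sequence $(A_n[M])_{M\ge0}$ is increasing and $A_n[\infty]:=\bigcup_{M\ge 0}A_n[M]$. For $z\in\mathcal{H}$, $$X_z(n):=\max\{|z'_1|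 :\ z'\in A_n[\infty],\ z'_i=z_i\ \text{for all } i=2,\dots,d\},$$ the largest absolute value of the first coordinate of an occupied site on the line through $z$ parallel to the first coordinate axis. *)

(* Defs.v *)
From HB Require Import structures.
From mathcomp Require Import all_boot all_order all_algebra finmap.
From mathcomp Require Import all_classical all_reals all_analysis.
From mathcomp Require Import zify.

Set Implicit Arguments.
Unset Strict Implicit.
Unset Printing Implicit Defensive.

Import Order.TTheory GRing.Theory Num.Theory.
Import numFieldNormedType.Exports.

Local Open Scope classical_set_scope.
Local Open Scope ring_scope.

(** The lattice Z^D is [site d] with D = d.+1, so that coordinates are indexed
    by ['I_d.+1] and the first coordinate of [z] is [z 0 ord0]. *)
Definition site (d : nat) := 'rV[int]_d.+1.

Definition supnorm (d : nat) (z : site d) : nat := (\max_i absz (z 0%R i))%N.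

Definition source (d : nat) : set (site d) := [set z | z 0 ord0 = 0].

Definition lex_le (d : nat) : rel (site d) := fun x y =>
  ([seq x 0%R i | i <- enum 'I_d.+1] <= [seq y 0%R i | i <- enum 'I_d.+1]
     :> seqlexi int)%O.

(** All sites of the cube {-M, ..., M}^D. *)
Definition box (d M : nat) : seq (site d) :=
  [seq \row_i ((f i)%:Z - M%:Z) | f : {ffun 'I_d.+1 -> 'I_(2 * M).+1}].

(** The sources of norm M, in lexicographical order (see [mem_level],
    [level_uniq] and [level_sorted]). *)
Definition level (d M : nat) : seq (site d) :=
  sort (@lex_le d) [seq z : site d <- box d M | (z 0 ord0 == 0) && (supnorm z == M)].

(** The direction [(i, b)] is the unit vector (-1)^b e_i. *)
Definition direction (d : nat) : finType := ('I_d.+1 * bool)%type.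

Definition unit_step (d : nat) (e : direction d) : site d :=
  (-1) ^+ e.2 *: delta_mx 0 e.1.

Definition walk (d : nat) (z : site d) (s : nat -> direction d) (t : nat) :
    site d :=
  z + \sum_(i < t) unit_step (s i).

(** [settle A w] adds to [A] the first site outside [A] visited by the
    trajectory [w]. If [w] never leaves [A], then nothing is added; for a
    random walk and a finite set [A] this has probability 0. *)
Definition settle (d : nat) (A : {fset site d}) (w : nat -> site d) :
    {fset site d} :=
  match pselect (exists t, w t \notin A) with
  | left h => (w (ex_minn h) |` A)%fset
  | right _ => A
  end.

(** A realisation of the steps of all the particles: [xi (z, k, t)] is the step
    taken at time [t] by the particle number [k] sent from [z]. *)
Definition send (d : nat) (xi : site d * nat * nat -> direction d) (n : nat)
    (A : {fset site d}) (z : site d) : {fset site d} :=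
  foldl (fun B k => settle B (walk z (fun t => xi (z, k, t)))) A (iota 0 n).

Fixpoint aggregate (d : nat) (xi : site d * nat * nat -> direction d)
    (n M : nat) : {fset site d} :=
  match M with
  | 0%N => send xi n fset0 0
  | M'.+1 => foldl (send xi n) (aggregate xi n M') (level d M'.+1)
  end.

Definition aggregate_infty (d : nat) (xi : site d * nat * nat -> direction d)
    (n : nat) : set (site d) :=
  \bigcup_M [set` aggregate xi n M].

(** The supremum of a nonempty set of integers in the extended reals is its
    maximum if the set is bounded, and +oo otherwise. *)
Definition height (R : realType) (d : nat)
    (xi : site d * nat * nat -> direction d) (n : nat) (z : site d) : \bar R :=
  ereal_sup [set (absz (z' 0%R ord0))%:R%:E | z' in
    aggregate_infty xi n `&` [set z' | forall i, i != ord0 -> z' 0 i = z 0 i]].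

Definition Over (R : realType) (T : Type) (d : nat)
    (xi : site d * nat * nat -> T -> direction d) (M : nat) (eps : R) (n : nat) :
    set T :=
  \bigcup_(l in [set l | (M <= l)%N])
    [set w | exists z : site d, [/\ source z, supnorm z = l &
      ((eps * l%:R)%:E < height R (fun p => xi p w) n z)%E]].

(** The family [xi] consists of independent random variables which are uniform
    on the 2D directions. *)
Record srw_steps (R : realType) (disp : measure_display)
    (T : measurableType disp) (P : probability T R) (d : nat)
    (xi : site d * nat * nat -> T -> direction d) : Prop := SrwSteps {
  srw_measurable : forall p (B : set (direction d)), measurable (xi p @^-1` B);
  srw_uniform : forall p (e : direction d),
    P (xi p @^-1` [set e]) = ((2 * d.+1)%:R^-1)%:E;
  srw_independent : forall (J : {fset site d * nat * nat})
      (B : site d * nat * nat -> set (direction d)),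
    P (\bigcap_(p in [set` J]) (xi p @^-1` B p)) =
    (\prod_(p <- J) P (xi p @^-1` B p))%E
}.

Lemma mem_box (d M : nat) (z : site d) : (z \in box d M) = (supnorm z <= M)%N.
Proof.
apply/idP/idP.
  move=> /mapP[f _ ->]; apply/bigmax_leqP => i _; rewrite mxE.
  by case: (f i) => a aM /=; lia.
move=> /bigmax_leqP zM; apply/mapP.
have zi i : (absz (z 0%R i + M%:Z)%R < (2 * M).+1)%N by have := zM i isT; lia.
exists [ffun i => Ordinal (zi i)]; first by rewrite mem_enum.
by apply/rowP => i; rewrite mxE ffunE /=; have := zM i isT; lia.
Qed.

Lemma box_uniq (d M : nat) : uniq (box d M).
Proof.
rewrite map_inj_uniq ?enum_uniq // => f g /rowP fg; apply/ffunP => i.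
by apply/val_inj; have := fg i; rewrite !mxE /=; lia.
Qed.

Lemma mem_level (d M : nat) (z : site d) :
  (z \in level d M) = (z 0 ord0 == 0) && (supnorm z == M).
Proof.
rewrite mem_sort mem_filter mem_box; case: eqP => //= _.
by case: eqP => //= ->; rewrite leqnn.
Qed.

Lemma level_uniq (d M : nat) : uniq (level d M).
Proof. by rewrite sort_uniq filter_uniq// box_uniq. Qed.

Lemma level_sorted (d M : nat) : sorted (@lex_le d) (level d M).
Proof. by apply: sort_sorted => x y; exact: le_total. Qed.

(** With [srw_steps], the event [Over] is measurable. *)
Section measurability.
Context (disp : measure_display) (T : measurableType disp).

Let discrete_measurable_fun (X : Type) (f : T -> X) :=
  forall B : set X, measurable (f @^-1` B).

Let bigcup_countType (X : countType) (F : X -> set T) :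
  (forall x, measurable (F x)) -> measurable (\bigcup_x F x).
Proof. by move=> mF; apply: countable_bigcupT_measurable. Qed.

Let dmeas_comp (X : countType) (Y : Type) (f : T -> X) (g : X -> T -> Y) :
  (forall x, measurable (f @^-1` [set x])) ->
  (forall x, discrete_measurable_fun (g x)) ->
  discrete_measurable_fun (fun w => g (f w) w).
Proof.
move=> mf mg B.
rewrite (_ : _ @^-1` B = \bigcup_x (f @^-1` [set x] `&` g x @^-1` B)).
  by apply: bigcup_countType => x; apply: measurableI; [exact: mf|exact: mg].
apply/seteqP; split => w /= => [Bw|[x _ [<-]]//].
by exists (f w).
Qed.

Let dmeas_cst (X : Type) (x : X) : discrete_measurable_fun (fun=> x).
Proof.
move=> B; have [Bx|Bx] := pselect (B x).
  by rewrite (_ : _ @^-1` _ = setT)//; apply/seteqP; split.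
by rewrite (_ : _ @^-1` _ = set0)//; apply/seteqP; split.
Qed.

Let dmeas_settle (d : nat) (f : T -> {fset site d}) (W : T -> nat -> site d) :
  discrete_measurable_fun f ->
  (forall t, discrete_measurable_fun (W ^~ t)) ->
  discrete_measurable_fun (fun w => settle (f w) (W w)).
Proof.
move=> mf mW; apply: (dmeas_comp (g := fun A w => settle A (W w))) => // A.
pose N w : option nat :=
  match pselect (exists t, W w t \notin A) with
  | left h => Some (ex_minn h) | right _ => None end.
have -> : (fun w => settle A (W w)) =
    (fun w => if N w is Some t then (W w t |` A)%fset else A).
  by apply/funext => w; rewrite /settle /N; case: pselect.
apply: (dmeas_comp (g := fun o w =>
  if o is Some t then (W w t |` A)%fset else A)); last first.
  move=> [t|]; last exact: dmeas_cst.
  apply: (dmeas_comp (g := fun x _ => (x |` A)%fset) (f := W ^~ t)) => x.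
    exact: mW.
  exact: dmeas_cst.
have mA t : measurable [set w | W w t \in A] by exact: (mW t [set x | x \in A]).
move=> [t|].
  rewrite (_ : _ @^-1` _ = ~` [set w | W w t \in A] `&`
      \bigcap_(i in [set i | (i < t)%N]) [set w | W w i \in A]).
    apply: measurableI; first exact: measurableC.
    exact: bigcap_measurableType.
  apply/seteqP; split => w /=; rewrite /N.
    case: pselect => // h [<-]; case: ex_minnP => m mA' mmin.
    split; first exact/negP.
    by move=> i /= im; apply/negPn/negP => /mmin; rewrite leqNgt im.
  move=> [/negP wt wlt]; case: pselect => [h|]; last by case; exists t.
  congr Some; case: ex_minnP => m mA' mmin; apply/eqP.
  rewrite eqn_leq mmin//= leqNgt; apply/negP => /wlt /=.
  by move/negP: mA'.
rewrite (_ : _ @^-1` _ = \bigcap_t [set w | W w t \in A]).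
  exact: bigcap_measurableType.
apply/seteqP; split => w /=; rewrite /N.
  case: pselect => // h _ t _ /=; apply/negPn/negP => wt; apply: h.
  by exists t.
move=> wA; case: pselect => // -[t wt].
by have := wA t I; rewrite /= (negbTE wt).
Qed.

Context (d : nat) (xi : site d * nat * nat -> T -> direction d).
Context (mxi : forall p (B : set (direction d)), measurable (xi p @^-1` B)).

Let dmeas_walk (z : site d) (k t : nat) :
  discrete_measurable_fun (fun w => walk z (fun t => xi (z, k, t) w) t).
Proof.
rewrite /walk; elim: t => [|t IH].
  under eq_fun do rewrite big_ord0 addr0; exact: dmeas_cst.
under eq_fun do rewrite big_ord_recr addrA.
apply: (dmeas_comp (g := fun x w => x + unit_step (xi (z, k, t) w))) => // x B.
exact: (mxi (z, k, t) ((fun e => x + unit_step e) @^-1` B)).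
Qed.

Let dmeas_send (n : nat) (f : T -> {fset site d}) (z : site d) :
  discrete_measurable_fun f ->
  discrete_measurable_fun (fun w => send (fun p => xi p w) n (f w) z).
Proof.
rewrite /send; elim: (iota 0 n) f => [//|k s IH] f mf /=.
by apply: IH; apply: dmeas_settle => // t; exact: dmeas_walk.
Qed.

Lemma measurable_aggregate (n M : nat) (B : set {fset site d}) :
  measurable [set w | B (aggregate (fun p => xi p w) n M)].
Proof.
suff : discrete_measurable_fun (fun w => aggregate (fun p => xi p w) n M).
  exact.
elim: M {B} => [|M IH] /=; first by apply: dmeas_send; exact: dmeas_cst.
suff foldP (s : seq (site d)) (f : T -> {fset site d}) :
    discrete_measurable_fun f -> discrete_measurable_fun
      (fun w => foldl (send (fun p => xi p w) n) (f w) s).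
  exact: foldP.
elim: s f => [//|z s IHs] f mf /=.
apply: (IHs (fun w => send (fun p => xi p w) n (f w) z)).
exact: dmeas_send.
Qed.

Lemma measurable_Over (R : realType) (M n : nat) (eps : R) :
  measurable (Over xi M eps n).
Proof.
apply: bigcup_measurable => l _.
rewrite (_ : [set w | _] = \bigcup_(z : site d) \bigcup_(z' : site d) \bigcup_m
   ([set w | z' \in aggregate (fun p => xi p w) n m] `&`
    [set _ | [/\ source z, supnorm z = l, forall i, i != ord0 -> z' 0 i = z 0 i
      & ((eps * l%:R)%:E < (absz (z' 0%R ord0))%:R%:E)%E]])).
  apply: bigcup_countType => z; apply: bigcup_countType => z'.
  apply: bigcup_countType => m; apply: measurableI.
    exact: (measurable_aggregate n m [set A | z' \in A]).
  exact: (dmeas_cst _ [set b : Prop | b]).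
apply/seteqP; split => w /=.
  move=> [z [z0 zl /ereal_sup_gt[_ [z' [[m _ z'm] z'z] <-] lt]]].
  by exists z => //; exists z' => //; exists m.
move=> [z _ [z' _ [m _ [/= z'm [z0 zl z'z lt]]]]]; exists z; split => //.
apply: (lt_le_trans lt); apply: ereal_sup_ubound; exists z' => //.
by split => //; exists m.
Qed.

End measurability.

(* Main.v *)
Require Import Defs.
From mathcomp Require Import all_boot all_order all_algebra finmap.
From mathcomp Require Import all_classical all_reals all_analysis.
From mathcomp Require Import zify lra.

Set Implicit Arguments.
Unset Strict Implicit.
Unset Printing Implicit Defensive.

Import Order.TTheory GRing.Theory Num.Theory.
Import numFieldNormedType.Exports.

Local Open Scope ring_scope.

(** Let s(M) be a multiple of log M and H(M) = s(M)^2. The aggregate obtained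
    from the levels up to M typically lies in the slab |x_1| < H(M), and a
    particle of level M which stays in that slab typically never comes within
    horizontal distance M/2 of the first axis. When both happen for every level
    above 2l, a site y of horizontal norm l is either settled by the levels up
    to 2l, so that |y_1| < H(2l), which is below [eps l] for large l; or it is
    settled by a particle of a level M > 2l, which would have travelled inside
    the slab of level M from norm M to norm at most M/2. Hence the event of the
    theorem is contained in the union, over the levels from M on, of two kinds
    of exceptional events ([aggregate_infty_flat]). Each has a probability
    smaller than any power of 1/M, and a union bound concludes.

    Height of the aggregate. Let the walks go on forever, ignoring the
    aggregate. By translation invariance along the hyperplane of sources, the
    expected number of walks which enter the layer |x_1| = k at a given site x
    is at most n: for a fixed sequence of steps, at most one source leads to x
    ([count_first_hit]). The walks being independent, this number has an
    exponential tail, so that no site of any layer is the entrance of more than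
    s particles, up to a probability of order 2^-s times a power of M
    ([card_crowd], [rare_crowd]). On the complementary event, let a_k be the
    number of settled sites with |x_1| >= k. The particle which settles such a
    site enters layer k at a site which is occupied in the end, and at most s
    particles share an entrance, so layer k contains at least a_k / s settled
    sites ([layer_count]): a_(k+1) <= (1 - 1/s) a_k. After s^2 layers nothing is
    left, as 2^s exceeds the number of particles ([settle_all_elev]).

    Crossing a slab. The function (2 H^2 - x_1^2) (1 + 1/H)^(-x_i) is
    nonnegative and superharmonic for |x_1| <= H ([barrier_superharmonic]), so
    that a walk confined to that slab goes from x_i = M to x_i = M/2 with
    probability at most 2 (1 + 1/H)^(-M/2) <= 2^(1-s), because M >= 2 H s
    ([crossing_bound], [rare_crossing]).

    All walk estimates are made for finitely many steps, where probabilities are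
    proportions of sequences of directions ([rare_steps]) and inductions on the
    number of steps replace stopping times; the number of steps then tends to
    infinity ([rare_bigcup_nondecreasing]). *)

(** * Charging the settled sites to particles *)

Definition particle (d : nat) := (site d * nat)%type.

Definition elev (d : nat) (x : site d) : nat := absz (x 0 ord0).

Definition route (d : nat) (xi : particle d * nat -> direction d)
    (p : particle d) : nat -> site d :=
  walk p.1 (fun t => xi (p, t)).

Definition settle_all (d : nat) (P : Type) (W : P -> nat -> site d)
    (A : {fset site d}) (ps : seq P) : {fset site d} :=
  foldl (fun B p => settle B (W p)) A ps.

Fixpoint particles (d n M : nat) : seq (particle d) :=
  match M with
  | 0%N => [seq (0, k) | k <- iota 0 n]
  | M'.+1 => particles d n M' ++
      [seq (z, k) | z <- level d M'.+1, k <- iota 0 n]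
  end.

Lemma settle_allE (d : nat) (xi : particle d * nat -> direction d) (n M : nat) :
  aggregate xi n M = settle_all (route xi) fset0 (particles d n M).
Proof.
have sendE B z : send xi n B z =
    settle_all (route xi) B [seq (z, k) | k <- iota 0 n].
  by rewrite /send /settle_all; elim: (iota 0 n) B => [//|k s IH] B /=.
elim: M => [|M IH] /=; first exact: sendE.
rewrite IH /settle_all foldl_cat; move: (foldl _ _ (particles d n M)).
elim: (level d M.+1) => [//|z s IHs] B /=.
by rewrite foldl_cat IHs sendE.
Qed.

Lemma particles_source (d n M : nat) (p : particle d) :
  p \in particles d n M -> p.1 0 ord0 = 0 /\ (supnorm p.1 <= M)%N.
Proof.
elim: M => [|M IH] /=.
  move=> /mapP[k _ ->] /=; rewrite mxE; split=> //.
  by apply/bigmax_leqP => i _; rewrite mxE.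
rewrite mem_cat => /orP[/IH[-> pM]|]; first by split=> //; exact: leqW.
by move=> /allpairsP[[z k] /= [+ _ ->]] /=; rewrite mem_level => /andP[/eqP-> /eqP->].
Qed.

Lemma particles_index (d n M : nat) (p : particle d) :
  p \in particles d n M -> (p.2 < n)%N.
Proof.
elim: M => [|M IH] /=; first by move=> /mapP[k]; rewrite mem_iota => /= kn ->.
rewrite mem_cat => /orP[/IH//|].
by move=> /allpairsP[[z k] /= [_ +  ->]] /=; rewrite mem_iota.
Qed.

Lemma particles_uniq (d n M : nat) : uniq (particles d n M).
Proof.
elim: M => [|M IH] /=.
  by rewrite map_inj_uniq ?iota_uniq// => i j [].
rewrite cat_uniq IH allpairs_uniq ?level_uniq ?iota_uniq//; last first.
  by move=> [? ?] [? ?] _ _ [-> ->].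
rewrite andbT; apply/hasPn => p /allpairsP[[z k] /= [zM _ ->]].
apply/negP => /particles_source[_ /=].
by move: zM; rewrite mem_level => /andP[_ /eqP->]; rewrite ltnn.
Qed.

Lemma size_particles (d n M : nat) :
  (size (particles d n M) <= n * (2 * M).+1 ^ d.+1)%N.
Proof.
have -> : (n * (2 * M).+1 ^ d.+1 =
    size [seq (z, k) | z <- box d M, k <- iota 0 n])%N.
  by rewrite size_allpairs size_iota size_map -cardE card_ffun !card_ord mulnC.
apply: uniq_leq_size; first exact: particles_uniq.
move=> [z k] zkM; apply/allpairsP; exists (z, k); split=> //=.
  by rewrite mem_box; have [] := particles_source zkM.
by rewrite mem_iota/=; exact: particles_index zkM.
Qed.

Lemma settle_sub (d : nat) (A : {fset site d}) (w : nat -> site d) :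
  {subset A <= settle A w}.
Proof.
by move=> x xA; rewrite /settle; case: pselect => // h; rewrite in_fset1U xA orbT.
Qed.

(** Every new site can be charged to the particle which settles it, distinct
    sites to distinct particles, and the trajectory of that particle up to its
    settling time lies in the final aggregate. *)
Lemma settle_all_settler (d : nat) (P : eqType) (W : P -> nat -> site d)
    (A : {fset site d}) (p0 : P) (ps : seq P) : uniq ps ->
  exists f : site d -> P,
    {in [pred y in settle_all W A ps | y \notin A] &, injective f} /\
    forall y, y \in settle_all W A ps -> y \notin A ->
      f y \in ps /\ exists2 t, W (f y) t = y &
        forall u, (u <= t)%N -> W (f y) u \in settle_all W A ps.
Proof.
elim/last_ind: ps => [|ps p IH].
  exists (fun=> p0); split=> [y y'|y yA /negP//].
  by rewrite inE => /andP[yA /negP[]].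
rewrite rcons_uniq => /andP[pps /IH[f [finj fP]]].
rewrite /settle_all -cats1 foldl_cat /= -/(settle_all W A ps) {IH}.
set B := settle_all W A ps in finj fP *.
rewrite /settle; case: pselect => [h|nh]; last first.
  exists f; split=> // y yB yA; have [fyps ?] := fP y yB yA.
  by rewrite mem_cat fyps.
case: ex_minnP => t WtB tmin; set y0 := W p t in WtB *.
exists (fun y => if y == y0 then p else f y); split.
  move=> y y'; rewrite !inE => /andP[yB yA] /andP[y'B y'A].
  have [yy0|yy0] := eqVneq y y0; have [y'y0|y'y0] := eqVneq y' y0.
  - by rewrite yy0 y'y0.
  - move: y'B; rewrite (negbTE y'y0)/= => y'B.
    by have [+ _] := fP y' y'B y'A => /[swap] <-; rewrite (negbTE pps).
  - move: yB; rewrite (negbTE yy0)/= => yB.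
    by have [+ _] := fP y yB yA => /[swap] ->; rewrite (negbTE pps).
  - move: yB y'B; rewrite (negbTE yy0) (negbTE y'y0)/= => yB y'B.
    by apply: finj; rewrite !inE ?yB ?y'B ?yA ?y'A.
move=> y; rewrite in_fset1U; have [->|yy0] := eqVneq y y0 => /= yB yA.
  rewrite mem_cat inE eqxx orbT; split=> //; exists t => // u.
  rewrite leq_eqVlt => /predU1P[->|ut]; first by rewrite in_fset1U eqxx.
  rewrite in_fset1U; apply/orP; right; apply/negPn/negP => /tmin.
  by rewrite leqNgt ut.
have [fyps [u Wu uP]] := fP y yB yA; rewrite mem_cat fyps; split=> //.
by exists u => // v /uP; rewrite in_fset1U => ->; rewrite orbT.
Qed.

(** * Few entrances per site make the aggregate flat *)

Lemma walk0 (d : nat) (z : site d) s : walk z s 0 = z.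
Proof. by rewrite /walk big_ord0 addr0. Qed.

Lemma walk_recl (d : nat) (z : site d) s t :
  walk z s t.+1 = walk (z + unit_step (s 0%N)) (fun u => s u.+1) t.
Proof. by rewrite /walk big_ord_recl addrA. Qed.

Lemma elev_step (d : nat) (x : site d) (e : direction d) :
  (elev (x + unit_step e)%R <= (elev x).+1)%N.
Proof.
rewrite /elev /unit_step !mxE eqxx; case: e => i [] /=;
rewrite ?expr0 ?expr1; case: (ord0 == i) => /=; lia.
Qed.

Lemma elev_walk_step (d : nat) (z : site d) s t :
  (elev (walk z s t.+1) <= (elev (walk z s t)).+1)%N.
Proof. by rewrite /walk big_ord_recr addrA; exact: elev_step. Qed.

Definition enters_layer_at (d k : nat) (w : nat -> site d) (x : site d) : Prop :=
  exists t, [/\ w t = x, elev x = k & forall u, (u < t)%N -> elev (w u) != k].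

Lemma enters_layerP (d k : nat) (w : nat -> site d) (t : nat) :
  elev (w 0%N) = 0%N -> (forall u, (elev (w u.+1) <= (elev (w u)).+1)%N) ->
  (k <= elev (w t))%N ->
  exists2 u, (u <= t)%N & enters_layer_at k w (w u).
Proof.
move=> w0 wS kt; have ex : exists u, (k <= elev (w u))%N by exists t.
case: (ex_minnP ex) => u ku umin; exists u; first exact: umin.
exists u; split=> // [|v vu]; last first.
  by apply/eqP => wv; have := umin v; rewrite wv leqnn leqNgt vu => /(_ isT).
apply/eqP; rewrite eqn_leq ku andbT; case: u ku umin => [|u] ku umin.
  by rewrite w0.
have := wS u; have [/umin|] := leqP k (elev (w u)); first by rewrite ltnn.
by lia.
Qed.

(** The settler of a site at height at least [k] enters layer [k] at a site
    of the final aggregate; a site of layer [k] is charged in this way by at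
    most [b] settlers. *)
Lemma layer_count (d : nat) (P : eqType) (W : P -> nat -> site d) (ps : seq P)
    (k b : nat) :
  uniq ps ->
  (forall p, p \in ps -> elev (W p 0%N) = 0%N) ->
  (forall p u, (elev (W p u.+1) <= (elev (W p u)).+1)%N) ->
  (forall x, (count (fun p => `[< enters_layer_at k (W p) x >]) ps <= b)%N) ->
  (count (fun y => (k <= elev y)%N) (settle_all W fset0 ps) <=
    b * count (fun y => elev y == k) (settle_all W fset0 ps))%N.
Proof.
move=> psU W0 WS fib; case: ps psU W0 fib => [|p0 ps0].
  move=> _ _ _; apply: leq_trans (leq0n _); rewrite leqNgt -has_count.
  by apply/hasPn.
set ps := p0 :: ps0; set A := settle_all W fset0 ps => psU W0 fib.
have [f [finj fP]] := settle_all_settler W fset0 p0 psU.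
rewrite -/A in finj fP.
have : forall y, exists x, y \in A -> (k <= elev y)%N ->
    x \in A /\ enters_layer_at k (W (f y)) x.
  move=> y; have [yA|] := boolP (y \in A); last by exists y.
  have [yk|] := boolP (k <= elev y)%N; last by exists y.
  have [fps [t Wt tP]] := fP y yA isT.
  have [|u ut ent] := enters_layerP (t := t) (W0 _ fps) (WS (f y)) (k := k).
    by rewrite Wt.
  by exists (W (f y) u) => _ _; split=> //; exact: tP.
move=> /choice[g gP].
rewrite -!sum1_count big_distrr/=.
apply: (@leq_trans (\sum_(y <- A | (k <= elev y)%N)
    \sum_(x <- A | elev x == k) (g y == x))%N).
  rewrite big_seq_cond [leqRHS]big_seq_cond; apply: leq_sum => y /andP[yA yk].
  have [gA [t [_ /eqP gk _]]] := gP y yA yk.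
  rewrite -big_filter (bigD1_seq (g y)) ?filter_uniq ?fset_uniq//= ?eqxx//.
  by rewrite mem_filter gk.
rewrite exchange_big /=; apply: leq_sum => x _; rewrite muln1 -big_mkcondr /=.
rewrite sum1_count; apply: leq_trans (fib x).
rewrite -!size_filter -(size_map f); apply: uniq_leq_size.
  rewrite map_inj_in_uniq ?filter_uniq ?fset_uniq// => y y'.
  rewrite !mem_filter => /andP[_ yA] /andP[_ y'A].
  by apply: finj; rewrite inE ?yA ?y'A.
move=> _ /mapP[y + ->]; rewrite !mem_filter /= => /andP[/andP[yk /eqP gx] yA].
have [fps _] := fP y yA isT; have [_ ent] := gP y yA yk.
by rewrite fps andbT; apply/asboolP; rewrite -gx.
Qed.

(** Along [b] consecutive steps each decrement is at least the last value
    divided by [b], so the sequence is at least halved. *)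
Lemma geometric_decrease (a : nat -> nat) (b m : nat) : (0 < b)%N ->
  (forall k, (k < b * m)%N -> (a k + b * a k.+1 <= b * a k)%N) ->
  (2 ^ m * a (b * m)%N <= a 0)%N.
Proof.
move=> b0; elim: m => [|m IH] aP; first by rewrite muln0 mul1n.
have : (2 * a (b * m.+1) <= a (b * m))%N.
  rewrite -(leq_pmul2l b0).
  (* For j = b this is 2 b a(bm + b) <= b a(bm). *)
  suff H j : (j <= b)%N ->
      ((j + b) * a (b * m + j) <= b * a (b * m))%N.
    by have := H b (leqnn b); rewrite mulnS addnC; nia.
  elim: j => [|j IHj] jb; first by rewrite addn0.
  have := aP (b * m + j)%N; rewrite mulnS => /(_ ltac:(lia)).
  have := IHj ltac:(lia); rewrite addnS; nia.
have := IH (fun k km => aP k ltac:(rewrite mulnS; lia)); rewrite expnS; nia.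
Qed.

Lemma settle_all_elev (d : nat) (P : eqType) (W : P -> nat -> site d)
    (ps : seq P) (b m : nat) :
  uniq ps ->
  (forall p, p \in ps -> elev (W p 0%N) = 0%N) ->
  (forall p u, (elev (W p u.+1) <= (elev (W p u)).+1)%N) ->
  (0 < b)%N -> (size ps < 2 ^ m)%N ->
  (forall k x, (k < b * m)%N ->
    (count (fun p => `[< enters_layer_at k (W p) x >]) ps <= b)%N) ->
  forall y, y \in settle_all W fset0 ps -> (elev y < b * m)%N.
Proof.
move=> psU W0 WS b0 psm fib y; set A := settle_all _ _ _ => yA.
pose a k := count (fun y => (k <= elev y)%N) A.
have aS k : a k = (count (fun y => elev y == k) A + a k.+1)%N.
  rewrite /a -count_predUI.
  have -> : count (predI (fun y => elev y == k) (fun y => (k < elev y)%N)) A = 0%N.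
    apply/eqP; rewrite -leqn0 leqNgt -has_count; apply/hasPn => x _ /=; lia.
  by rewrite addn0; apply: eq_count => x /=; lia.
have := geometric_decrease (a := a) (m := m) b0.
have aP k : (k < b * m)%N -> (a k + b * a k.+1 <= b * a k)%N.
  move=> km; have H := layer_count psU W0 WS (fun x => fib k x km).
  by rewrite -/A -/(a k) in H; rewrite {2}[a k]aS mulnDr leq_add2r.
move=> /(_ aP); rewrite ltnNge => H; apply/negP => yk.
have a1 : (0 < a (b * m))%N by rewrite /a -has_count; apply/hasP; exists y.
have : (a 0 <= size ps)%N.
  rewrite /a (eq_count (a2 := predT))// count_predT.
  case: ps psU {W0 fib psm} @A yA {a aS aP H a1} => [|p0 ps0]//.
  set ps := p0 :: ps0 => psU A yA.
  have [f [finj fP]] := settle_all_settler W fset0 p0 psU.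
  rewrite -(size_map f); apply: uniq_leq_size.
    rewrite map_inj_in_uniq ?fset_uniq// => x x' xA x'A.
    by apply: finj; rewrite inE ?xA ?x'A.
  by move=> _ /mapP[x xA ->]; have [] := fP x xA isT.
by move: psm H a1; nia.
Qed.

(** * Entrances of independent walks into a layer *)

Fixpoint first_hit (d k : nat) (x : site d) (s : seq (direction d)) :
    option (site d) :=
  if elev x == k then Some x
  else if s is e :: s' then first_hit k (x + unit_step e) s' else None.

Lemma mkseq_recl (X : Type) (f : nat -> X) (n : nat) :
  mkseq f n.+1 = f 0%N :: mkseq (fun i => f i.+1) n.
Proof. by rewrite /mkseq /= (iotaDl 1 0) -map_comp. Qed.

Lemma first_hit_walk (d k : nat) (z : site d) (s : nat -> direction d)
    (t T : nat) (x : site d) :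
  walk z s t = x -> elev x = k ->
  (forall u, (u < t)%N -> elev (walk z s u) != k) -> (t <= T)%N ->
  first_hit k z (mkseq s T) = Some x.
Proof.
move=> <-; elim: t T z s => [|t IH] T z s.
  by rewrite walk0 => zk _ _; case: T => [|T]; rewrite ?mkseq_recl /= zk eqxx.
case: T => [//|T]; rewrite walk_recl => wk before tT; rewrite mkseq_recl /=.
have := before 0%N isT; rewrite walk0 => /negbTE->.
by apply: IH => // u ut; rewrite -(walk_recl z s); exact: before.
Qed.

Lemma first_hitD (d k : nat) (x a : site d) (s : seq (direction d)) :
  a 0 ord0 = 0 ->
  first_hit k (x + a) s = omap (fun y => y + a) (first_hit k x s).
Proof.
move=> a0; elim: s x => [|e s IH] x /=;
  rewrite /elev !mxE a0 addr0; case: ifP => //= _.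
by rewrite addrAC IH.
Qed.

(** For given steps [s], the entrance of a walk into a layer moves along with
    its source, so only one source can lead to [x]. *)
Lemma count_first_hit (d k n : nat) (ps : seq (particle d))
    (s : seq (direction d)) (x : site d) :
  uniq ps -> (forall p, p \in ps -> p.1 0 ord0 = 0 /\ (p.2 < n)%N) ->
  (count (fun p => first_hit k p.1 s == Some x) ps <= n)%N.
Proof.
move=> psU psP; rewrite -size_filter -(size_map snd) -[leqRHS](size_iota 0).
apply: uniq_leq_size; last first.
  move=> _ /mapP[p + ->]; rewrite mem_filter mem_iota => /andP[_ pps] /=.
  by have [] := psP p pps.
rewrite map_inj_in_uniq ?filter_uniq// => -[z i] [z' i'].
rewrite !mem_filter => /andP[/= hz /psP[/= z0 _]] /andP[/= hz' /psP[/= z'0 _]] ->.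
congr pair; move: hz hz'; rewrite -[z]add0r -[z']add0r !first_hitD//.
by case: first_hit => // y /eqP[<-] /eqP[/addrI ->].
Qed.

(** Coordinates [w i] are independent and uniform on [S], and for every [x] the
    expected number of indices with [h i (w i) = x] is at most [n]. Counting
    separately the index [p] which reveals [x = h p (w p)], the number of other
    indices with the same value exceeds [b - 1] with probability at most
    [2^-b] times the expectation of 2 to that number, which is a product of
    factors [1 + P(h q = x) <= exp (P (h q = x))]. *)
Lemma card_crowd (R : realType) (I S : finType) (X : eqType)
    (h : I -> S -> option X) (n b : nat) :
  (0 < #|S|)%N ->
  (forall x, (\sum_i \sum_s (h i s == Some x) <= n * #|S|)%N) ->
  (#|[pred w : {ffun I -> S} | [exists p, (h p (w p) != None) &&
      (b < #|[pred q | h q (w q) == h p (w p)]|)%N]]|%:R : R) <=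
    #|I|%:R * expR n%:R * 2 ^- b * #|S|%:R ^+ #|I|.
Proof.
move=> S0 hS; set bad := fun w : {ffun I -> S} => _.
(* [\prod_q F p s q (w q)] is the indicator of [w p = s] times 2 to the number
   of the other indices whose value is [h p s]. *)
pose F p s q s' : R := if q == p then (s' == s)%:R
  else 1 + (h q s' == h p s)%:R.
have F0 p s q s' : 0 <= F p s q s' by rewrite /F; case: ifP => _; rewrite ?addr_ge0.
apply: (@le_trans _ _ (\sum_(w : {ffun I -> S}) \sum_p \sum_(s | h p s != None)
    2 ^- b * \prod_q F p s q (w q))).
  rewrite -sum1_card natr_sum big_mkcond /=; apply: ler_sum => w _.
  have nneg p s : 0 <= 2 ^- b * \prod_q F p s q (w q).
    by rewrite mulr_ge0 ?invr_ge0 ?exprn_ge0// prodr_ge0.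
  case: ifP => [|_]; last by apply: sumr_ge0 => p _; exact: sumr_ge0.
  move=> /existsP[p /andP[hp crowd]].
  rewrite (bigD1 p)//= (bigD1 (w p))//=.
  suff main : 1 <= 2 ^- b * \prod_q F p (w p) q (w q).
    apply: (le_trans main); rewrite -addrA lerDl addr_ge0 ?sumr_ge0// => q _.
    exact: sumr_ge0.
  rewrite mulrC ler_pdivlMr ?exprn_gt0// mul1r (bigD1 p)//= {1}/F !eqxx mul1r.
  rewrite (eq_bigr (fun q => if h q (w q) == h p (w p) then 2 else 1 : R)).
    rewrite -big_mkcondr prodr_const ler_weXn2l// ?ler1n//.
    move: crowd; rewrite [in X in (b < X)%N](cardD1 p) !inE eqxx ltnS.
    move=> /leq_trans; apply.
    by apply/eq_leq/eq_card => q; rewrite !inE.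
  by move=> q /negbTE qp; rewrite /F qp; case: eqP => // _; rewrite addr0.
rewrite exchange_big/=.
apply: (@le_trans _ _ (\sum_(p : I) \sum_(s : S)
    2 ^- b * (expR n%:R * #|S|%:R ^+ #|I|.-1))); last first.
  rewrite !sumr_const -[leLHS]mulr_natl -[X in _ * X]mulr_natl.
  case: #|I| => [|N]; first by rewrite !mul0r.
  rewrite le_eqVlt; apply/orP; left; apply/eqP.
  move: (2 ^- b) (expR _) (#|S|%:R) (N.+1%:R) => a e s m.
  rewrite exprS !mulrA; congr (_ * _); rewrite -!mulrA; congr (_ * _).
  by rewrite mulrC -mulrA mulrCA.
apply: ler_sum => p _; rewrite exchange_big/= big_mkcond/=.
apply: ler_sum => s _; case: ifP => [hps|_]; last first.
  by rewrite !mulr_ge0 ?invr_ge0 ?exprn_ge0 ?expR_ge0.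
rewrite -big_distrr/= ler_wpM2l ?invr_ge0 ?exprn_ge0//.
rewrite -(bigA_distr_bigA (F p s)) (bigD1 p)//= {1}/F eqxx.
rewrite -natr_sum (bigD1 s)//= eqxx big1 => [|s' /negbTE->//].
rewrite addn0 mul1r.
case hpsx : (h p s) hps => [x|//] _.
pose c q := (\sum_s' (h q s' == Some x))%N.
apply: (@le_trans _ _ (\prod_(q | q != p) (#|S|%:R * expR ((c q)%:R / #|S|%:R)))).
  apply: ler_prod => q /negbTE qp; rewrite sumr_ge0 => [/=|s' _]; last exact: F0.
  rewrite /F qp hpsx big_split /= sumr_const -natr_sum -/(c q).
  apply: le_trans (ler_wpM2l _ (expR_ge1Dx _)) => //.
  by rewrite mulrDr mulr1 mulrCA divff ?mulr1// pnatr_eq0 -lt0n.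
rewrite big_split/= prodr_const -expR_sum mulrC.
have -> : #|[pred q | q != p]| = #|I|.-1 by rewrite -(cardC1 p).
rewrite ler_wpM2r ?exprn_ge0// ler_expR -mulr_suml ler_pdivrMr ?ltr0n//.
rewrite -natr_sum -natrM ler_nat; apply: leq_trans (hS x).
by rewrite [leqRHS](bigID (fun q => q != p))/= leq_addr.
Qed.

(** * Crossing a slab *)

Fixpoint crosses (d H : nat) (tgt : pred (site d)) (x : site d)
    (s : seq (direction d)) : bool :=
  (elev x < H)%N &&
  (tgt x || if s is e :: s' then crosses H tgt (x + unit_step e) s' else false).

Lemma crosses_walk (d H : nat) (tgt : pred (site d)) (z : site d)
    (s : nat -> direction d) (t T : nat) :
  tgt (walk z s t) -> (forall u, (u <= t)%N -> (elev (walk z s u) < H)%N) ->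
  (t <= T)%N -> crosses H tgt z (mkseq s T).
Proof.
elim: t T z s => [|t IH] T z s.
  move=> wt /(_ 0%N isT); rewrite walk0 => wH _.
  by rewrite walk0 in wt; case: T => [|T]; rewrite ?mkseq_recl /= wH wt.
case: T => [//|T]; rewrite walk_recl => wt wH tT; rewrite mkseq_recl /=.
have := wH 0%N isT; rewrite walk0 => -> /=; apply/orP; right.
by apply: IH => // u ut; rewrite -(walk_recl z s); exact: wH.
Qed.

Lemma sum_tupleS (R : realType) (A : finType) (T : nat) (F : seq A -> R) :
  \sum_(s : T.+1.-tuple A) F s = \sum_(a : A) \sum_(s : T.-tuple A) F (a :: s).
Proof.
rewrite pair_bigA/= (reindex (fun p : A * T.-tuple A => [tuple of p.1 :: p.2]))//=.
exists (fun s : T.+1.-tuple A => (thead s, [tuple of behead s])).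
  by move=> [a s] _ /=; congr pair; apply: val_inj.
by move=> s _ /=; rewrite -tuple_eta.
Qed.

(** [tau] is a sign: it selects one of the two orientations of axis [i]. *)
Section slab.
Context (R : realType) (d H : nat) (i : 'I_d.+1) (tau : int).
Hypotheses (H0 : (0 < H)%N) (i0 : i != ord0) (tau1 : absz tau = 1%N).

Let beta : R := 1 + H%:R^-1.

Let beta_gt0 : 0 < beta.
Proof. by rewrite addr_gt0// invr_gt0 ltr0n. Qed.

Let ell (x : site d) : R := beta ^ (tau * x 0 i).

Definition barrier (x : site d) : R :=
  (2 * H%:R ^+ 2 - (elev x)%:R ^+ 2) * ell x.

Let ell_gt0 x : 0 < ell x. Proof. exact: exprz_gt0. Qed.

Lemma barrier_ge0 x : (elev x <= H)%N -> 0 <= barrier x.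
Proof.
move=> xH; rewrite mulr_ge0 ?(ltW (ell_gt0 _))// subr_ge0.
rewrite -[leLHS]mul1r ler_pM ?ler1n ?sqr_ge0//.
by rewrite ler_pXn2r// ?nnegrE// ler_nat.
Qed.

Let sqr_elev (x : site d) : (elev x)%:R ^+ 2 = (x 0 ord0)%:~R ^+ 2 :> R.
Proof.
by rewrite /elev natr_absz intr_norm real_normK ?num_real.
Qed.

(** The two steps along the first axis decrease the sum by [2 ell x], whereas
    those along axis [i] increase it by at most [(2 H^2) ell x / H^2], because
    [beta + beta^-1 <= 2 + 1 / H^2]. *)
Lemma barrier_superharmonic x : (elev x < H)%N ->
  \sum_(e : direction d) barrier (x + unit_step e) <=
    (2 * d.+1)%:R * barrier x.
Proof.
move=> xH.
rewrite -(pair_bigA _ (fun j b => barrier (x + unit_step (j, b))))/=.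
have coordE j b : (x + unit_step (j, b)) 0 =1
    (fun k => x 0 k + (-1) ^+ b * (k == j)%:R).
  by move=> k; rewrite /unit_step !mxE eqxx.
have splitE j : \sum_b barrier (x + unit_step (j, b)) =
    barrier (x + unit_step (j, true)) + barrier (x + unit_step (j, false)).
  by rewrite big_bool.
rewrite (bigD1 ord0)//= (bigD1 i)//=.
have -> : \sum_(j < d.+1 | (j != ord0) && (j != i))
    \sum_b barrier (x + unit_step (j, b)) =
    \sum_(j < d.+1 | (j != ord0) && (j != i)) 2 * barrier x.
  apply: eq_bigr => j /andP[j0 ji].
  rewrite splitE /barrier !sqr_elev /ell !coordE.
  rewrite ![_ == j]eq_sym (negbTE j0) (negbTE ji) !mulr0 !addr0; lra.
have -> : \sum_b barrier (x + unit_step (ord0, b)) = 2 * barrier x - 2 * ell x.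
  rewrite splitE /barrier !sqr_elev /ell !coordE (negbTE i0) eqxx !mulr0 !addr0.
  by rewrite !intrD !expr0 !expr1 !mulr1 /=; lra.
have : \sum_b barrier (x + unit_step (i, b)) <= 2 * barrier x + 2 * ell x.
  rewrite splitE /barrier !sqr_elev /ell !coordE eq_sym (negbTE i0) eqxx.
  rewrite !mulr0 !addr0 !mulr1 expr0 expr1 !mulrDr mulr1 mulrN1.
  rewrite !expfzDr ?gt_eqF// -/(ell x).
  have -> : beta ^ (- tau) = (beta ^ tau)^-1 by rewrite invr_expz.
  set q := 2 * _ - _; set u := ell x; set h := H%:R^-1 : R.
  have u0 : 0 < u by exact: ell_gt0.
  have h0 : 0 < h by rewrite invr_gt0 ltr0n.
  have q2 : q * h ^+ 2 <= 2.
    by rewrite /h exprVn ler_pdivrMr ?exprn_gt0 ?ltr0n// gerBl sqr_ge0.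
  have sumE : beta ^ tau + (beta ^ tau)^-1 = beta + beta^-1.
    have : tau = 1 \/ tau = -1 by lia.
    by case=> ->; rewrite ?expr1z// exprN1 invrK addrC.
  have sum_le : beta + beta^-1 <= 2 + h ^+ 2.
    rewrite -lerBrDl -[_^-1]mul1r ler_pdivrMr// /beta -/h.
    by nra.
  have -> : q * (u * (beta ^ tau)^-1) + q * (u * beta ^ tau) =
      q * u * (beta + beta^-1) by rewrite -sumE; lra.
  have q0 : 0 <= q.
    by have := barrier_ge0 (ltnW xH); rewrite /barrier sqr_elev -/q pmulr_lge0.
  have := ler_wpM2l (mulr_ge0 q0 (ltW u0)) sum_le.
  have := ler_wpM2r (ltW u0) q2.
  by lra.
have -> : (2 * d.+1)%:R * barrier x = 2 * barrier x + (2 * barrier x +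
   \sum_(j < d.+1 | (j != ord0) && (j != i)) 2 * barrier x).
  rewrite -[in RHS](bigD1 i (P := fun j => j != ord0) (F := fun=> 2 * barrier x))//=.
  rewrite -[in RHS](bigD1 ord0 (P := predT) (F := fun=> 2 * barrier x))//=.
  by rewrite sumr_const card_ord -[RHS]mulr_natl natrM mulrA [_ * 2]mulrC.
by move=> side; lra.
Qed.

(** Optional stopping for [barrier], which is at least [H^2 beta^-l] on the part
    of the target inside the slab. *)
Lemma crossing_bound (l : int) (tgt : pred (site d)) :
  (forall y, tgt y -> - l <= tau * y 0 i) ->
  forall T x, (elev x <= H)%N ->
  \sum_(s : T.-tuple (direction d))
      (crosses H tgt x s)%:R * (H%:R ^+ 2 * beta ^ (- l)) <=
    (2 * d.+1)%:R ^+ T * barrier x.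
Proof.
move=> tgtP; set c := _ * beta ^ _.
have c0 : 0 <= c by rewrite mulr_ge0 ?sqr_ge0// ltW// exprz_gt0.
have zero T x : (forall s, crosses H tgt x s = false) -> (elev x <= H)%N ->
    \sum_(s : T.-tuple (direction d)) (crosses H tgt x s)%:R * c <=
    (2 * d.+1)%:R ^+ T * barrier x.
  move=> xF xH; rewrite big1 => [|s _]; last by rewrite xF mul0r.
  by rewrite mulr_ge0 ?exprn_ge0 ?barrier_ge0.
have card_dir : #|{: direction d}| = (2 * d.+1)%N.
  by rewrite card_prod card_ord card_bool mulnC.
have hit T x : tgt x -> (elev x < H)%N ->
    \sum_(s : T.-tuple (direction d)) (crosses H tgt x s)%:R * c <=
    (2 * d.+1)%:R ^+ T * barrier x.
  move=> xt xH; apply: (@le_trans _ _ (\sum_(s : T.-tuple (direction d)) c)).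
    by apply: ler_sum => s _; rewrite ler_piMl// lern1 leq_b1.
  rewrite sumr_const card_tuple card_dir -[leLHS]mulr_natl natrX.
  rewrite ler_wpM2l ?exprn_ge0//.
  rewrite ler_pM ?sqr_ge0 ?(ltW (exprz_gt0 _ _))//.
    rewrite lerBrDl -[X in _ <= X * _]natr1 mulrDl mul1r lerD2r.
    by rewrite ler_pXn2r ?nnegrE// ler_nat ltnW.
  by rewrite ler_weXz2l ?tgtP// lerDl invr_ge0.
elim=> [|T IH] x xH; have [xlt|xge] := ltnP (elev x) H.
- have [xt|xt] := boolP (tgt x); first exact: hit.
  rewrite big1 => [|s _]; first by rewrite mulr_ge0 ?barrier_ge0.
  by rewrite (tuple0 s) /= (negbTE xt) andbF mul0r.
- by apply: zero => // -[|e s] /=; rewrite ltnNge xge.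
- have [xt|xt] := boolP (tgt x); first exact: hit.
  rewrite (sum_tupleS _ (fun s => (crosses H tgt x s)%:R * c)) /=.
  apply: (@le_trans _ _ (\sum_(e : direction d)
      (2 * d.+1)%:R ^+ T * barrier (x + unit_step e))).
    apply: ler_sum => e _; rewrite xlt (negbTE xt) /=; apply: IH.
    by apply: leq_trans xlt; exact: elev_step.
  by rewrite -mulr_sumr exprSr -mulrA ler_wpM2l ?exprn_ge0// barrier_superharmonic.
- by apply: zero => // -[|e s] /=; rewrite ltnNge xge.
Qed.
End slab.

(** * Exceptional events and finite horizons *)

Local Open Scope classical_set_scope.

Section rare.
Context (R : realType) (disp : measure_display) (T : measurableType disp)
  (P : probability T R).

(** An upper bound on the outer probability, which spares measurability proofs
    for the exceptional events. *)
Definition rare (A : set T) (r : R) : Prop :=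
  exists2 B, A `<=` B & measurable B /\ (P B <= r%:E)%E.

Lemma rareS (A B : set T) (r : R) : A `<=` B -> rare B r -> rare A r.
Proof. by move=> AB [C BC CP]; exists C => // w /AB /BC. Qed.

Lemma rareW (A : set T) (r r' : R) : r <= r' -> rare A r -> rare A r'.
Proof.
move=> rr' [B AB [mB Br]]; exists B => //; split=> //.
by rewrite (le_trans Br)// lee_fin.
Qed.

Lemma rareU (A B : set T) (r r' : R) :
  rare A r -> rare B r' -> rare (A `|` B) (r + r').
Proof.
move=> [A' AA' [mA' A'r]] [B' BB' [mB' B'r]]; exists (A' `|` B').
  exact: setUSS.
split; first exact: measurableU.
by apply: (le_trans (measureU2 _ mA' mB')); rewrite EFinD leeD.
Qed.

Lemma rare_bigcup_seq (X : eqType) (s : seq X) (F : X -> set T) (c : X -> R) :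
  (forall x, x \in s -> rare (F x) (c x)) ->
  rare (\bigcup_(x in [set` s]) F x) (\sum_(x <- s) c x).
Proof.
elim: s => [|x s IH] rareF.
  by rewrite big_nil; exists set0 => [w []//|]; rewrite measure0.
rewrite big_cons.
have -> : \bigcup_(y in [set` x :: s]) F y =
    F x `|` \bigcup_(y in [set` s]) F y.
  apply/seteqP; split => w.
    move=> [y /=]; rewrite inE => /predU1P[->|ys] Fy; first by left.
    by right; exists y.
  move=> [Fx|[y /= ys Fy]]; first by exists x => //=; rewrite inE eqxx.
  by exists y => //=; rewrite inE ys orbT.
apply: rareU; first by apply: rareF; rewrite inE eqxx.
by apply: IH => y ys; apply: rareF; rewrite inE ys orbT.
Qed.

Lemma rare_bigcup_nondecreasing (F : nat -> set T) (r : R) :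
  (forall m n, (m <= n)%N -> F m `<=` F n) -> (forall n, rare (F n) r) ->
  rare (\bigcup_n F n) r.
Proof.
move=> ndF rareF.
have [G GP] : exists G : nat -> set T, forall n,
    F n `<=` G n /\ measurable (G n) /\ (P (G n) <= r%:E)%E.
  have : forall n, exists B, F n `<=` B /\ measurable B /\ (P B <= r%:E)%E.
    by move=> n; have [B FB BP] := rareF n; exists B.
  by move=> /choice[G GP]; exists G.
(* The supersets [G n] need not increase, their tail intersections do. *)
pose G' n := \bigcap_(m in [set m | (n <= m)%N]) G m.
have mG' n : measurable (G' n).
  by apply: bigcap_measurableType => m _; case: (GP m) => _ [].
have mU : measurable (\bigcup_n G' n) by exact: bigcup_measurable.
exists (\bigcup_n G' n).
  move=> w [n _ Fw]; exists n => // m /= nm.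
  by case: (GP m) => FG _; apply: FG; exact: ndF Fw.
split=> //; have cvgG : P \o G' @ \oo --> P (\bigcup_n G' n).
  apply: nondecreasing_cvg_mu => // m n mn; apply/subsetPset => w G'w k /= nk.
  by apply: G'w; exact: leq_trans nk.
rewrite -(cvg_lim (@ereal_hausdorff R) cvgG); apply: lime_le.
  by apply/cvg_ex; exists (P (\bigcup_n G' n)).
apply: nearW => n /=; have [_ [mG Gr]] := GP n; apply: le_trans Gr.
by apply: le_measure; rewrite ?inE// => w; apply => /=.
Qed.
End rare.

Lemma uniform_bound (X : eqType) (s : seq X) (E : nat -> X -> Prop) :
  (forall m n x, (m <= n)%N -> E m x -> E n x) ->
  exists n, forall x, x \in s -> (exists m, E m x) -> E n x.
Proof.
move=> mE; elim: s => [|x s [n nP]]; first by exists 0%N.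
have [[m Em]|nEx] := pselect (exists m, E m x).
  exists (maxn m n) => y; rewrite inE => /predU1P[->|ys] Ey.
    by apply: mE Em; rewrite leq_maxl.
  by apply: mE (nP y ys Ey); rewrite leq_maxr.
by exists n => y; rewrite inE => /predU1P[->|/nP].
Qed.

Section finite_horizon.
Context (R : realType) (disp : measure_display) (T : measurableType disp)
  (P : probability T R) (d : nat) (xi : particle d * nat -> T -> direction d).
Hypothesis xiP : srw_steps P xi.

Let prob_steps (J : finType) (c : J -> particle d * nat) (g : J -> direction d) :
  injective c ->
  rare P [set w | forall j, xi (c j) w = g j] ((2 * d.+1)%:R ^- #|J|).
Proof.
move=> cI.
pose B q := [set e | forall j, c j = q -> e = g j].
pose fs := [fset c j | j in J]%fset.
exists (\bigcap_(q in [set` fs]) (xi q @^-1` B q)).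
  by move=> w /= wg q /= _ j <-.
have PB j : P (xi (c j) @^-1` B (c j)) = ((2 * d.+1)%:R^-1)%:E.
  rewrite -(srw_uniform xiP (c j) (g j)); congr (P (_ @^-1` _)).
  apply/seteqP; split => e /=; first exact.
  by move=> -> j' /cI ->.
split.
  apply: fin_bigcap_measurable; first exact: finite_fset.
  by move=> q _; exact: (srw_measurable xiP).
rewrite (srw_independent xiP) big_imfset//=; last by move=> ? ? _ _ /cI.
rewrite (eq_bigr (fun=> ((2 * d.+1)%:R^-1)%:E))//.
by rewrite prodEFin lee_fin /enum_finmem big_enum/= prodr_const exprVn.
Qed.

Definition steps_upto (p : particle d) (t : nat) (w : T) : t.-tuple (direction d) :=
  [tuple xi (p, val u) w | u < t].

Lemma steps_uptoE (p : particle d) (t : nat) (w : T) :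
  tval (steps_upto p t w) = mkseq (fun u => xi (p, u) w) t.
Proof.
rewrite /mkseq -val_enum_ord -map_comp; exact: eq_map.
Qed.

Lemma rare_steps (I : finType) (c : I -> particle d) (t : nat)
    (Q : pred {ffun I -> t.-tuple (direction d)}) : injective c ->
  rare P [set w | Q [ffun i => steps_upto (c i) t w]]
    (#|Q|%:R / ((2 * d.+1)%:R ^+ t) ^+ #|I|).
Proof.
move=> cI.
pose F (q : {ffun I -> t.-tuple (direction d)}) :=
  [set w | forall j : I * 'I_t, xi (c j.1, val j.2) w = tnth (q j.1) j.2].
apply: (@rareS _ _ _ _ _ (\bigcup_(q in [set` enum Q]) F q)).
  move=> w /= Qw; exists [ffun i => steps_upto (c i) t w] => /=.
    by rewrite mem_enum.
  by move=> [i u] /=; rewrite ffunE tnth_mktuple.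
have -> : #|Q|%:R / ((2 * d.+1)%:R ^+ t) ^+ #|I| =
    \sum_(q <- enum Q) (2 * d.+1)%:R ^- #|{: I * 'I_t}| :> R.
  rewrite big_enum sumr_const -[RHS]mulr_natl card_prod card_ord.
  by rewrite [(#|I| * t)%N]mulnC exprM.
apply: rare_bigcup_seq => q _; apply: prob_steps => -[i u] [i' u'] [].
by move=> /cI -> /val_inj ->.
Qed.

Let rt w := route (fun q => xi q w).

(** The union bound over [x] costs only a factor [size ps], since [x] is the
    entrance of some particle. *)
Lemma rare_crowd (ps : seq (particle d)) (n k b : nat) :
  uniq ps -> (forall p, p \in ps -> p.1 0 ord0 = 0 /\ (p.2 < n)%N) ->
  rare P [set w | exists x,
      (b < count (fun p => `[< enters_layer_at k (rt w p) x >]) ps)%N]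
    ((size ps)%:R * expR n%:R * 2 ^- b).
Proof.
move=> psU psP.
(* [E w x t p] is the entrance before time [t], an event which depends on
   finitely many steps and increases with [t]. *)
pose E w x t p := exists u, [/\ (u <= t)%N, rt w p u = x, elev x = k &
  forall v, (v < u)%N -> elev (rt w p v) != k].
apply: (@rareS _ _ _ _ _ (\bigcup_t
    [set w | exists x, (b < count (fun p => `[< E w x t p >]) ps)%N])).
  move=> w /= [x bx].
  have [t tP] : exists t, forall p, p \in ps -> (exists u, E w x u p) -> E w x t p.
    apply: uniform_bound => m m' p mm' [u [um ? ? ?]].
    by exists u; split=> //; exact: leq_trans mm'.
  exists t => //; exists x; apply: leq_trans bx _.
  rewrite -!size_filter; apply: uniq_leq_size; first exact: filter_uniq.
  move=> p; rewrite !mem_filter => /andP[/asboolP[u [ux xk uP]] pps].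
  by rewrite pps andbT; apply/asboolP/(tP _ pps); exists u, u.
apply: rare_bigcup_nondecreasing => [t t' tt' w /= [x bx]|t].
  exists x; apply: (leq_trans bx); apply: sub_count => p /asboolP[u [ut ? ? ?]].
  by apply/asboolP; exists u; split=> //; exact: leq_trans tt'.
pose c (i : 'I_(size ps)) := tnth (in_tuple ps) i.
have cI : injective c by apply/tuple_uniqP.
pose S := t.-tuple (direction d).
pose h i (s : S) := first_hit k (c i).1 s.
have S0 : (0 < #|{: S}|)%N.
  by rewrite card_tuple expn_gt0 card_prod card_ord card_bool.
have hS x : (\sum_i \sum_s (h i s == Some x) <= n * #|{: S}|)%N.
  rewrite exchange_big /= mulnC -sum_nat_const; apply: leq_sum => s _.
  rewrite -(big_tnth _ _ ps predT
    (fun p => nat_of_bool (first_hit k p.1 s == Some x))).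
  by rewrite -big_mkcond sum1_count; exact: count_first_hit.
have crowd := card_crowd R b S0 hS.
set Q := (X in #|X|) in crowd.
apply: (rareS (B := [set w | Q [ffun i => steps_upto (c i) t w]])); last first.
  apply: rareW (rare_steps Q cI).
  rewrite card_ord in crowd *.
  rewrite ler_pdivrMr ?exprn_gt0//; apply: le_trans crowd _.
  by rewrite card_tuple card_prod card_ord card_bool natrX [(_.+1 * 2)%N]mulnC.
move=> w /= [x bx]; rewrite /Q /=.
have hE p : p \in ps -> E w x t p -> first_hit k p.1 (steps_upto p t w) = Some x.
  by move=> pps [u [ut ux xk uP]]; rewrite steps_uptoE; exact: first_hit_walk uP ut.
have [p pps Ep] : exists2 p, p \in ps & E w x t p.
  have /hasP[p pps /asboolP Ep] : has (fun p => `[< E w x t p >]) ps.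
    by rewrite has_count; exact: leq_trans bx.
  by exists p.
have /tnthP[i ip] : p \in in_tuple ps by [].
apply/existsP; exists i; rewrite !ffunE /h /c -ip hE//=.
apply: leq_trans bx _; rewrite -sum1_count big_tnth sum1_card.
apply: subset_leq_card; apply/fintype.subsetP => j; rewrite !inE ffunE.
by move=> Ej; apply/eqP/hE; first exact: (mem_tnth j (in_tuple ps)).
Qed.

Lemma two_le_pow (m : nat) : (0 < m)%N -> 2 <= (1 + m%:R^-1 : R) ^+ m.
Proof.
move=> m0; have h0 : 0 <= m%:R^-1 :> R by rewrite invr_ge0.
have bern q : 1 + q%:R * m%:R^-1 <= (1 + m%:R^-1 : R) ^+ q.
  elim: q => [|q IH]; first by rewrite mul0r addr0.
  rewrite exprS -natr1; have : 0 <= q%:R :> R by [].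
  move: IH h0; set h := m%:R^-1; set y := _ ^+ q; set a := q%:R; nra.
by apply: le_trans (bern m); rewrite divff ?pnatr_eq0 -?lt0n.
Qed.

(** Some horizontal coordinate of the source has absolute value [M], and has to
    be brought down to [M / 2] inside the slab. *)
Lemma rare_crossing (p : particle d) (M H s : nat) :
  p.1 0 ord0 = 0 -> supnorm p.1 = M -> (0 < H)%N -> (2 * (H * s) <= M)%N ->
  (0 < M)%N ->
  rare P [set w | exists t,
      (forall i, i != ord0 -> (2 * absz (rt w p t 0%R i) <= M)%N) /\
      forall u, (u <= t)%N -> (elev (rt w p u) < H)%N]
    (2 * 2 ^- s).
Proof.
move=> p0 pM H0 HsM M0.
pose tgt (y : site d) := [forall i, (i != ord0) ==> (2 * absz (y 0%R i) <= M)%N].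
apply: (@rareS _ _ _ _ _ (\bigcup_t [set w | exists2 u, (u <= t)%N &
    tgt (rt w p u) /\ forall v, (v <= u)%N -> (elev (rt w p v) < H)%N])).
  move=> w /= [t [tM tH]]; exists t => //; exists t => //; split=> //.
  by apply/forallP => i; apply/implyP; exact: tM.
apply: rare_bigcup_nondecreasing => [t t' tt' w /= [u ut uP]|t].
  by exists u => //; exact: leq_trans tt'.
pose Q (q : {ffun 'I_1 -> t.-tuple (direction d)}) := crosses H tgt p.1 (q ord0).
apply: (rareS (B := [set w | Q [ffun i => steps_upto ((fun=> p) i) t w]])).
  move=> w /= [u ut [uM uH]]; rewrite /Q ffunE steps_uptoE.
  exact: crosses_walk uH ut.
apply: rareW (rare_steps Q _); last by move=> i j _; rewrite !ord1.
rewrite card_ord expr1 ler_pdivrMr ?exprn_gt0//.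
have QE : #|Q|%:R <= \sum_(s : t.-tuple (direction d)) (crosses H tgt p.1 s)%:R :> R.
  rewrite -natr_sum ler_nat -big_mkcond sum1_card.
  have ord0I : injective (fun q : {ffun 'I_1 -> t.-tuple (direction d)} => q ord0).
    by move=> q q' qq'; apply/ffunP => i; rewrite ord1.
  rewrite -(fintype.card_image ord0I); apply: subset_leq_card.
  by apply/fintype.subsetP => q /fintype.imageP[q' + ->].
apply: le_trans QE _.
have [i pi] : exists i, absz (p.1 0%R i) = M.
  have [|i iM] := bigop.eq_bigmax (fun i => absz (p.1 0%R i)).
    by rewrite card_ord.
  by exists i; rewrite -iM.
have i0 : i != ord0 by apply: contraTneq M0 => i0; rewrite -pi i0 p0.
pose tau : int := - sgz (p.1 0 i).
have tau1 : absz tau = 1%N by rewrite /tau; lia.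
have tgtP y : tgt y -> - (M./2)%:Z <= tau * y 0 i.
  move=> /forallP/(_ i); rewrite i0 /= => yM.
  have : tau = 1 \/ tau = -1 by lia.
  by case=> ->; lia.
have := crossing_bound R H0 i0 tau1 tgtP t (x := p.1).
rewrite /elev p0 => /(_ isT); rewrite -mulr_suml /barrier /elev p0.
set N := \sum_(s <- _) _; set beta := 1 + _.
have -> : tau * p.1 0 i = - M%:Z by rewrite /tau; lia.
have beta0 : 0 < beta by rewrite addr_gt0// invr_gt0 ltr0n.
have H2 : 0 < H%:R ^+ 2 :> R by rewrite exprn_gt0// ltr0n.
rewrite /= expr0n subr0 [_ * (_ * beta ^ _)]mulrA -ler_pdivlMr ?exprz_gt0//.
move=> NP.
have {}NP : N <= (2 * d.+1)%:R ^+ t * (2 * beta ^ (- M%:Z) / beta ^ (- (M./2)%:Z)).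
  rewrite -(ler_pM2r H2); apply: le_trans NP _.
  by rewrite le_eqVlt; apply/orP; left; apply/eqP; lra.
apply: le_trans NP _; rewrite mulrC ler_wpM2r ?exprn_ge0// -mulrA ler_wpM2l//.
rewrite invr_expz opprK -expfzDr ?gt_eqF//.
have -> : - M%:Z + (M./2)%:Z = - (M - M./2)%N%:Z by lia.
rewrite -invr_expz lef_pV2 ?posrE ?exprn_gt0//.
apply: (@le_trans _ _ ((beta ^+ H) ^+ s)).
  by rewrite lerXn2r ?nnegrE ?exprn_ge0 ?(ltW beta0) ?two_le_pow.
by rewrite -exprM ler_weXn2l ?lerDl ?invr_ge0//; lia.
Qed.
End finite_horizon.

(** * Shape of the aggregate outside exceptional events *)

Lemma settle_all_sub (d : nat) (P : Type) (W : P -> nat -> site d)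
    (A : {fset site d}) (ps : seq P) : {subset A <= settle_all W A ps}.
Proof.
elim: ps A => [|p ps IH] A x xA //; rewrite /settle_all /=.
by apply: IH; exact: settle_sub.
Qed.

Lemma aggregate_sub (d : nat) (xi : particle d * nat -> direction d)
    (n M M' : nat) :
  (M <= M')%N -> {subset aggregate xi n M <= aggregate xi n M'}.
Proof.
move=> /subnKC <-; elim: (M' - M)%N => [|m IH] x xM; first by rewrite addn0.
rewrite addnS settle_allE /= /settle_all foldl_cat -!/(settle_all _ _ _).
by rewrite -settle_allE; apply: settle_all_sub; exact: IH.
Qed.

Lemma aggregate_new (d : nat) (xi : particle d * nat -> direction d)
    (n M : nat) (y : site d) :
  y \in aggregate xi n M.+1 -> y \notin aggregate xi n M ->
  exists p, [/\ p \in particles d n M.+1, supnorm p.1 = M.+1 &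
    exists2 t, route xi p t = y &
      forall u, (u <= t)%N -> route xi p u \in aggregate xi n M.+1].
Proof.
pose ps := [seq (z, k) | z <- level d M.+1, k <- iota 0 n].
have psE : particles d n M.+1 = particles d n M ++ ps by [].
have -> : aggregate xi n M.+1 = settle_all (route xi) (aggregate xi n M) ps.
  by rewrite !settle_allE psE /settle_all foldl_cat.
have psU : uniq ps.
  by have := particles_uniq d n M.+1; rewrite psE cat_uniq; case/and3P.
have [f [_ fP]] := settle_all_settler (route xi) (aggregate xi n M) (0, 0%N) psU.
move=> yM yM'; have [fps ft] := fP y yM yM'.
exists (f y); split=> //; first by rewrite psE mem_cat fps orbT.
by move: fps => /allpairsP[[z k] /= [+ _ ->]] /=; rewrite mem_level => /andP[_ /eqP].
Qed.

Lemma aggregate_flat (d : nat) (xi : particle d * nat -> direction d)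
    (n M s : nat) : (0 < s)%N -> (size (particles d n M) < 2 ^ s)%N ->
  (forall k x, (k < s * s)%N ->
    (count (fun p => `[< enters_layer_at k (route xi p) x >])
      (particles d n M) <= s)%N) ->
  forall y, y \in aggregate xi n M -> (elev y < s * s)%N.
Proof.
move=> s0 sM crowd y; rewrite settle_allE; apply: settle_all_elev => //.
- exact: particles_uniq.
- by move=> p pM; rewrite /route walk0 /elev (particles_source pM).1.
- by move=> p u; exact: elev_walk_step.
Qed.

(** The failure of the hypothesis of [settle_all_elev] on layer counts. *)
Definition crowded (d : nat) (xi : particle d * nat -> direction d)
    (n s M : nat) : Prop :=
  exists2 k, k \in iota 0 (s * s) & exists x,
    (s < count (fun p => `[< enters_layer_at k (route xi p) x >])
      (particles d n M))%N.

(** The condition bears on the free walk: the aggregate only enters through the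
    slab which contains it, so that the event depends on a single walk for each
    particle. *)
Definition stretched (d : nat) (xi : particle d * nat -> direction d)
    (n s M : nat) : Prop :=
  exists2 p, p \in [seq p <- particles d n M | supnorm p.1 == M] &
    exists t, (forall i, i != ord0 -> (2 * absz (route xi p t 0%R i) <= M)%N) /\
      forall u, (u <= t)%N -> (elev (route xi p u) < s * s)%N.

(** Consider the first level [M] whose particles settle [y]. If [M <= 2 l], the
    aggregate of level [2 l] contains [y] and is flat. Otherwise the settler of
    [y] comes from norm [M > 2 l] and stays in the aggregate of level [M],
    which is flat: this makes level [M] stretched. *)
Lemma aggregate_infty_flat (d : nat) (xi : particle d * nat -> direction d)
    (n l : nat) (s : nat -> nat) (y : site d) :
  (forall M, (2 * l <= M)%N -> [/\ (0 < s M)%N,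
    (size (particles d n M) < 2 ^ s M)%N, ~ crowded xi n (s M) M &
    ~ stretched xi n (s M) M]) ->
  aggregate_infty xi n y ->
  (forall i, i != ord0 -> (absz (y 0%R i) <= l)%N) ->
  (elev y < s (2 * l) * s (2 * l))%N.
Proof.
move=> good [M0 _ /= yM0] yl.
have flat M : (2 * l <= M)%N -> forall x, x \in aggregate xi n M ->
    (elev x < s M * s M)%N.
  move=> /good[s0 sM nocrowd _]; apply: aggregate_flat => // k x ks.
  rewrite leqNgt; apply/negP => crowd; apply: nocrowd.
  by exists k; [rewrite mem_iota|exists x].
have [/flat|ynot] := boolP (y \in aggregate xi n (2 * l)); first exact.
have [M yM Mmin] := ex_minnP (ex_intro (fun M => y \in aggregate xi n M) M0 yM0).
have lM : (2 * l < M)%N.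
  rewrite ltnNge; apply/negP => Ml; move: ynot.
  by rewrite (aggregate_sub Ml yM).
case: M lM yM Mmin => [//|M] lM yM Mmin.
have yM' : y \notin aggregate xi n M by apply/negP => /Mmin; rewrite ltnn.
have [p [pM pM1 [t ty tA]]] := aggregate_new yM yM'.
have [_ _ _ nostretch] := good M.+1 (ltnW lM); case: nostretch; exists p.
  by rewrite mem_filter pM1 eqxx.
exists t; split=> [i /yl|u /tA]; last by apply: flat; exact: ltnW.
by rewrite ty; lia.
Qed.

(** * Probability of an exceptional level *)

Section bad_levels.
Context (R : realType) (disp : measure_display) (T : measurableType disp)
  (P : probability T R) (d : nat) (xi : particle d * nat -> T -> direction d).
Hypothesis xiP : srw_steps P xi.

Lemma rare_crowded_or_stretched (n s M : nat) :
  (0 < s)%N -> (0 < M)%N -> (2 * (s * s * s) <= M)%N ->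
  rare P [set w | crowded (fun p => xi p w) n s M \/
      stretched (fun p => xi p w) n s M]
    ((size (particles d n M) * M)%:R * (expR n%:R + 2) * 2 ^- s).
Proof.
move=> s0 M0 sM.
have sM2 : (s * s <= M)%N by nia.
apply: (@rareW _ _ _ _ _ (\sum_(k <- iota 0 (s * s))
     (size (particles d n M))%:R * expR n%:R * 2 ^- s +
   \sum_(p <- [seq p <- particles d n M | supnorm p.1 == M]) 2 * 2 ^- s)).
  rewrite !big_const_seq !count_predT size_iota !iter_addr_0.
  have fM : (size [seq p <- particles d n M | supnorm p.1 == M] <=
      size (particles d n M) * M)%N.
    by rewrite size_filter; apply: leq_trans (count_size _ _) (leq_pmulr _ M0).
  move: (size (particles d n M)) (size [seq _ <- _ | _]) fM => N N' N'M.
  rewrite -[X in X + _]mulr_natl -[X in _ + X]mulr_natl !mulrA -mulrDl.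
  rewrite ler_wpM2r ?invr_ge0 ?exprn_ge0// [leRHS]mulrDr -natrM mulnC.
  by rewrite lerD// ler_wpM2r ?expR_ge0// ler_nat ?leq_mul2l ?sM2 ?orbT.
apply: (rareS (B := (\bigcup_(k in [set` iota 0 (s * s)]) [set w | exists x,
   (s < count (fun p => `[< enters_layer_at k (route (fun q => xi q w) p) x >])
      (particles d n M))%N]) `|`
   (\bigcup_(p in [set` [seq p <- particles d n M | supnorm p.1 == M]])
     [set w | exists t,
       (forall i, i != ord0 ->
         (2 * absz (route (fun q => xi q w) p t 0%R i) <= M)%N) /\
       forall u, (u <= t)%N ->
         (elev (route (fun q => xi q w) p u) < s * s)%N]))).
  by move=> w [[k ks kx]|[p pM pt]]; [left; exists k|right; exists p].
apply: rareU.
  apply: rare_bigcup_seq => k _; apply: rare_crowd => //.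
    exact: particles_uniq.
  move=> p pM; have [p0 _] := particles_source pM.
  by split=> //; exact: particles_index pM.
apply: rare_bigcup_seq => p.
rewrite mem_filter => /andP[/eqP pM /particles_source[p0 _]].
by apply: rare_crossing => //; rewrite ?muln_gt0 ?s0 // mulnA.
Qed.
End bad_levels.

Definition binlen (m : nat) : nat := (trunc_log 2 m).+1.

Lemma ltn_binlen m : (m < 2 ^ binlen m)%N.
Proof. exact: trunc_log_ltn. Qed.

(** With [j] the integer logarithm of [m] and [q = j %/ 4], one has
    [j + 1 <= 4 (q + 1) <= 4 * 2^q], so [c (j + 1)^3 <= 64 c * 2^(3q)], which
    is at most [2^(4q) <= m] once [64 c <= q]. *)
Lemma binlen_cube (c : nat) : exists m0, forall m, (m0 <= m)%N ->
  (c * binlen m ^ 3 <= m)%N.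
Proof.
exists (2 ^ (4 * (64 * c)))%N => m m0m.
have m_gt0 : (0 < m)%N by apply: leq_trans m0m; rewrite expn_gt0.
have := trunc_logP (isT : 1 < 2)%N m_gt0.
have := trunc_log_max (isT : 1 < 2)%N m0m.
rewrite /binlen; set j := trunc_log 2 m => jc; apply: leq_trans.
set q := (j %/ 4)%N.
have qj : (4 * q <= j < 4 * q.+1)%N by rewrite /q; lia.
have qc : (64 * c <= q)%N by rewrite /q; lia.
have q2 : (q.+1 <= 2 ^ q)%N by exact: ltn_expl.
apply: (@leq_trans (2 ^ (4 * q))%N); last by rewrite leq_exp2l//; lia.
apply: (@leq_trans (c * (4 * 2 ^ q) ^ 3)%N).
  by rewrite leq_mul2l leq_exp2r//; apply/orP; right; lia.
rewrite [(4 * q)%N]mulnC expnM expnMn mulnA (expnS _ 3) leq_mul2r.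
by apply/orP; right; move: (2 ^ q)%N q2 => a; lia.
Qed.

(** Telescoping, from [1 / r^2 <= 2 / r - 2 / (r + 1)]. *)
Lemma sum_inv_sqr_le (R : realType) (M m : nat) : (0 < M)%N ->
  \sum_(r <- iota M m) (r%:R ^- 2 : R) <= 2.
Proof.
move=> M0; suff : \sum_(r <- iota M m) (r%:R ^- 2 : R) + 2 / (M + m)%:R <= 2 / M%:R.
  move=> H; apply: (@le_trans _ _ (2 / M%:R)).
    by apply: le_trans H; rewrite lerDl divr_ge0.
  by rewrite ler_pdivrMr ?ltr0n// ler_peMr// ler1n.
elim: m => [|m IH]; first by rewrite big_nil add0r addn0.
rewrite -addn1 iotaD big_cat big_seq1 addn1 addnS; apply: le_trans IH.
rewrite -addrA lerD2l; set r := (M + m)%N.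
have r1 : 1 <= r%:R :> R by rewrite ler1n /r; lia.
rewrite -[r.+1%:R]natr1 -exprVn; move: (r%:R : R) r1 => {}r r1.
have /mulVf hu : r != 0 by apply/lt0r_neq0; lra.
have /mulVf hv : r + 1 != 0 by apply/lt0r_neq0; lra.
have u0 : 0 < r^-1 by rewrite invr_gt0; lra.
have v0 : 0 < (r + 1)^-1 by rewrite invr_gt0; lra.
move: r^-1 (r + 1)^-1 hu hv u0 v0 => u v hu hv u0 v0.
have uv : u - v = u * v.
  have : u * (v * (r + 1)) = u by rewrite hv mulr1.
  have : v * (u * r) = v by rewrite hu mulr1.
  by lra.
have u2v : u <= 2 * v.
  have : 0 <= u * v * (r - 1) by rewrite !mulr_ge0//; lra.
  have : v * (u * r) = v by rewrite hu mulr1.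
  by lra.
have : u * u <= u * (2 * v) by rewrite ler_wpM2l// ltW.
by lra.
Qed.

Section tail.
Context (R : realType) (d n q K : nat).
(** A level [m] has probability at most [m^(d + 2) 2^-s] of being bad, up to a
    constant, and [2^-s <= m^-K]: the exponent [K] leaves [m^-(q + 2)], that is
    the wanted [m^-q] and a summable factor. *)
Hypothesis Kq : K = (d + q + 4)%N.

Definition log_width (m : nat) : nat := (K * binlen m)%N.

Definition tail_cst : R := (n * 3 ^ d.+1)%:R * (expR n%:R + 2).

Lemma size_particles_le (m : nat) : (0 < m)%N ->
  (size (particles d n m) <= n * 3 ^ d.+1 * m ^ d.+1)%N.
Proof.
move=> m0; apply: leq_trans (size_particles _ _ _) _.
by rewrite -mulnA -expnMn leq_mul2l leq_exp2r//; apply/orP; right; lia.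
Qed.

Lemma log_width_exp (m : nat) : (m ^ K <= 2 ^ log_width m)%N.
Proof.
have K0 : (0 < K)%N by rewrite Kq addn_gt0 orbT.
by rewrite /log_width mulnC expnM (leq_exp2r _ _ K0); exact/ltnW/ltn_binlen.
Qed.

Lemma size_particles_lt (m : nat) : (n * 3 ^ d.+1 < m)%N ->
  (size (particles d n m) < 2 ^ log_width m)%N.
Proof.
move=> nm; have m0 : (0 < m)%N by exact: leq_ltn_trans nm.
apply: leq_ltn_trans (size_particles_le m0) _; apply: leq_trans (log_width_exp m).
apply: (@leq_trans (m ^ d.+2)).
  by rewrite [(m ^ d.+2)%N]expnS ltn_mul2r expn_gt0 m0.
by rewrite leq_pexp2l// Kq; lia.
Qed.

Context (disp : measure_display) (T : measurableType disp)
  (P : probability T R) (xi : particle d * nat -> T -> direction d).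
Hypothesis xiP : srw_steps P xi.

Definition bad_level (m : nat) : set T :=
  [set w | crowded (fun p => xi p w) n (log_width m) m \/
      stretched (fun p => xi p w) n (log_width m) m].

Lemma rare_bad_level (m : nat) : (0 < m)%N -> (2 * log_width m ^ 3 <= m)%N ->
  rare P (bad_level m) (tail_cst * m%:R ^- q * m%:R ^- 2).
Proof.
move=> m0 sm; apply: rareW (rare_crowded_or_stretched xiP n _ m0 _); last 2 first.
- by rewrite /log_width muln_gt0 Kq addn_gt0 orbT.
- by move: sm; rewrite !expnS muln1 !mulnA.
have mR : 0 < m%:R :> R by rewrite ltr0n.
rewrite ler_pdivrMr ?exprn_gt0// /tail_cst.
apply: (@le_trans _ _ ((n * 3 ^ d.+1 * m ^ d.+2)%:R * (expR n%:R + 2))).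
  rewrite ler_wpM2r ?addr_ge0 ?expR_ge0// ler_nat [(m ^ d.+2)%N]expnSr mulnA.
  by rewrite leq_mul2r size_particles_le ?orbT.
rewrite natrM -[leLHS]mulrA [leLHS]mulrCA [leLHS]mulrC -!mulrA.
rewrite ler_wpM2l// ler_wpM2l ?addr_ge0 ?expR_ge0// mulrA -invfM -exprD.
rewrite ler_pdivlMl ?exprn_gt0// natrX -exprD.
apply: (@le_trans _ _ (m%:R ^+ K)); last by rewrite -!natrX ler_nat log_width_exp.
by rewrite Kq le_eqVlt; apply/orP; left; apply/eqP; congr (_ ^+ _); lia.
Qed.

Lemma rare_bad_levels (M : nat) : (0 < M)%N ->
  (forall m, (M <= m)%N -> (2 * log_width m ^ 3 <= m)%N) ->
  rare P (\bigcup_(m in [set m | (M <= m)%N]) bad_level m)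
    (2 * tail_cst * M%:R ^- q).
Proof.
move=> M0 sm.
apply: (rareS (B := \bigcup_k \bigcup_(m in [set` iota M k]) bad_level m)).
  move=> w [m /= Mm bw]; exists m.+1 => //; exists m => //.
  have : m \in iota M m.+1 by rewrite mem_iota; lia.
  by [].
apply: rare_bigcup_nondecreasing => [k k' kk' w [m /= mk bw]|k].
  by exists m => //=; move: mk; rewrite !mem_iota; lia.
have c0 : 0 <= tail_cst by rewrite mulr_ge0 ?addr_ge0 ?expR_ge0.
apply: (@rareW _ _ _ _ _
    (\sum_(m <- iota M k) tail_cst * M%:R ^- q * m%:R ^- 2)).
  rewrite -mulr_sumr -[leRHS]mulrA [leRHS]mulrC.
  by rewrite ler_wpM2l ?mulr_ge0 ?invr_ge0 ?exprn_ge0 ?sum_inv_sqr_le.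
apply: rare_bigcup_seq => m; rewrite mem_iota => /andP[Mm _].
have m0 : (0 < m)%N by exact: leq_trans Mm.
apply: rareW (rare_bad_level m0 (sm m Mm)).
rewrite ler_wpM2r ?invr_ge0 ?exprn_ge0// ler_wpM2l//.
by rewrite lef_pV2 ?posrE ?exprn_gt0 ?ltr0n// lerXn2r ?nnegrE// ler_nat.
Qed.
End tail.

Theorem theorem4p1 (R : realType) (d n : nat)
    (hd : (3 <= d.+1)%N) (hn : (1 <= n)%N)
    (L : R) (hL : 1 < L) (eps : R) (heps : 0 < eps) :
  exists2 C : R, 0 < C &
    forall (disp : measure_display) (T : measurableType disp)
      (P : probability T R) (xi : site d * nat * nat -> T -> direction d),
      srw_steps P xi ->
      forall M : nat, (2 <= M)%N ->
        (P (Over xi M eps n) <= (C / (M%:R `^ L))%:E)%E.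
Proof.
pose q := Num.bound L.
have Lq : L <= q%:R by apply/ltW/archi_boundP; lra.
pose K := (d + q + 4)%N.
have K0 : (0 < K)%N by rewrite /K addn_gt0 orbT.
pose e := Num.bound eps^-1.
have e1 : 1 <= eps * e%:R.
  rewrite -[leLHS](@divff _ eps) ?gt_eqF// ler_wpM2l ?ltW//.
  by apply/archi_boundP; rewrite invr_ge0 ltW.
(* One growth condition serves twice: slabs of height [s^2] are crossed rarely
   at level [m] since [2 s^3 <= m], and [s^2 <= eps * l] at level [2 * l]. *)
have [M1 M1P] := binlen_cube (2 * e.+1 * K ^ 3).
pose M0 := (maxn M1 (n * 3 ^ d.+1)).+1.
have log_widthP m : (M0 <= m)%N -> (2 * e.+1 * log_width K m ^ 3 <= m)%N.
  move=> m0; rewrite /log_width expnMn mulnA; apply: M1P.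
  by apply: leq_trans m0; rewrite /M0 ltnW// ltnS leq_maxl.
pose C := 2 * tail_cst R d n + M0%:R `^ L.
have c0 : 0 <= tail_cst R d n by rewrite mulr_ge0 ?addr_ge0 ?expR_ge0.
have pow0 : 0 < M0%:R `^ L :> R by apply: powR_gt0; rewrite ltr0n.
exists C; first by rewrite /C ltr_wpDl// mulr_ge0.
move=> disp T P xi xiP M M2.
have ML0 : 0 < M%:R `^ L :> R by apply: powR_gt0; rewrite ltr0n; lia.
(* Small [M]: the second term of [C] makes the bound at least 1. *)
have [MM0|M0M] := ltnP M M0.
  apply: (le_trans (probability_le1 P _)).
    by apply: measurable_Over; exact: (srw_measurable xiP).
  rewrite lee_fin ler_pdivlMr// mul1r.
  apply: (@le_trans _ _ (M0%:R `^ L)); last by rewrite /C lerDr mulr_ge0.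
  by apply: ge0_ler_powR; rewrite ?nnegrE//; [lra|rewrite ler_nat ltnW].
have M_gt0 : (0 < M)%N by lia.
have small m : (M <= m)%N -> (2 * e.+1 * log_width K m ^ 3 <= m)%N.
  by move=> Mm; apply: log_widthP; exact: leq_trans Mm.
have small2 m : (M <= m)%N -> (2 * log_width K m ^ 3 <= m)%N.
  by move=> /small; apply: leq_trans; rewrite -mulnA leq_mul2l leq_pmull.
have [B badB [mB PB]] := rare_bad_levels n (erefl K) xiP M_gt0 small2.
apply: (@le_trans _ _ (P B)); last first.
  apply: (le_trans PB); rewrite lee_fin ler_pdivlMr//.
  apply: (@le_trans _ _ (2 * tail_cst R d n)); last by rewrite /C lerDl ltW.
  rewrite -[leRHS]mulr1 -[leLHS]mulrA ler_wpM2l ?mulr_ge0//.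
  rewrite mulrC ler_pdivrMr ?exprn_gt0 ?ltr0n// mul1r -powR_mulrn//.
  by rewrite ler_powR// ler1n.
apply: le_measure; rewrite ?inE//.
  by apply: measurable_Over; exact: (srw_measurable xiP).
move=> w [l /= Ml [z [z0 zl /ereal_sup_gt[_ [y [yA yz] <-]]]]].
rewrite lte_fin => ly; apply: badB; apply: contrapT => good.
suff : ((elev y)%:R <= eps * l%:R) by rewrite leNgt ly.
have yl i : i != ord0 -> (absz (y 0%R i) <= l)%N.
  by move=> /yz ->; rewrite -zl; exact: (@leq_bigmax _ (fun i => absz (z 0%R i)) i).
have := aggregate_infty_flat (s := log_width K) _ yA yl.
have Ml2 : (M <= 2 * l)%N by rewrite mul2n -addnn (leq_trans Ml)// leq_addr.
set s := log_width K (2 * l) => /(_ _)/ltnW ys.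
have {}ys : (elev y <= s * s)%N.
  apply: ys => m lm; have Mm := leq_trans Ml2 lm; split.
  - by rewrite /log_width muln_gt0 K0.
  - apply: (size_particles_lt (q := q)) => //.
    by apply: leq_trans (leq_trans M0M Mm); rewrite ltnS leq_maxr.
  - by move=> cr; apply: good; exists m => //; left.
  - by move=> st; apply: good; exists m => //; right.
have sl : (e * (s * s) <= l)%N.
  have s0 : (0 < s)%N by rewrite /s /log_width muln_gt0 K0.
  have := small _ Ml2; rewrite -/s !expnS expn0 muln1 -mulnA leq_pmul2l//.
  by apply: leq_trans; rewrite leq_mul// leq_pmull.
apply: (@le_trans _ _ (s * s)%:R); first by rewrite ler_nat.
apply: (@le_trans _ _ (eps * (e * (s * s))%:R)); last first.
  by apply: ler_wpM2l; [exact: ltW|rewrite ler_nat].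
by rewrite [(e * (s * s))%:R]natrM mulrA ler_peMl.
Qed.
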